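(* Let $n\geq 1$ and let $\lambda$ be a partition of $n$ having $k_j$ parts of size $j$ ($1\le j\le n$) and $k=\sum_j k_j$ parts in total. Let $P_{\lambda,n}$ be the number of polygonal dissections of type $\lambda$ of a fixed convex $(n+2)$-gon. For a sequence $\mathbf r=(r_0,r_1,\dots,r_m)$ let $T_{\mathbf r,m}$ be the number of rooted plane trees on $m+1$ vertices with downdegree sequence $\mathbf r$. Then $P_{\lambda,n}=T_{\mathbf r,m}$ for $\mathbf r=(n+1,0,k_1,k_2,\dots,k_n)$ (padded with zeros to length $m+1$) and $m=n+k$.
   Context: A polygonal dissection of a convex polygon is the union of the polygon with a set of pairwise non-crossing diagonals; the regions it creates are convex polygons. A dissection of an $(n+2)$-gon is of type $\lambda$ (for $\lambda$ a partition of $n$ with $k_j$ parts of size $j$) if its regions consist of exactly $k_j$ regions that are $(j+2)$-gons, for each $j$. A rooted plane tree is a plane (ordered) tree with a distinguished root vertex; its downdegree sequence $(r_0,r_1,\dots)$ records in $r_j$ the number of vertices having exactly $j$ neighbors farther from the root than the vertex itself. *)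

(* Defs.v *)
From HB Require Import structures.
From mathcomp Require Import all_boot.

Set Implicit Arguments.
Unset Strict Implicit.
Unset Printing Implicit Defensive.

Definition is_partition (n : nat) (la : seq nat) : bool :=
  [&& sorted geq la, 0 \notin la & sumn la == n].

(* The vertices of a convex N-gon are numbered 0, ..., N-1 in cyclic order, and
   a segment joining two of them is the ordered pair of its endpoints, smaller
   one first. *)
Definition is_segment N (e : 'I_N * 'I_N) : bool := e.1 < e.2.

(* The segment e is a side of the convex polygon spanned by the vertex set S
   exactly when all the other vertices of S lie on the same side of e. *)
Definition is_side N (S : {set 'I_N}) (e : 'I_N * 'I_N) : bool :=
  [&& is_segment e, e.1 \in S, e.2 \in S &
      [forall s in S, (s <= e.1) || (e.2 <= s)]
      || [forall s in S, e.1 <= s <= e.2]].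

Definition is_diagonal N (S : {set 'I_N}) (e : 'I_N * 'I_N) : bool :=
  [&& is_segment e, e.1 \in S, e.2 \in S & ~~ is_side S e].

Definition crossing N (e f : 'I_N * 'I_N) : bool :=
  (e.1 < f.1 < e.2) && (e.2 < f.2) || (f.1 < e.1 < f.2) && (f.2 < e.2).

(* A dissection of the N-gon is identified with its set of diagonals. *)
Definition dissection N (D : {set 'I_N * 'I_N}) : bool :=
  [forall e in D, is_diagonal [set: 'I_N] e]
  && [forall e in D, forall f in D, ~~ crossing e f].

(* A region is identified with its set of vertices: it is a polygon all of whose
   sides are drawn (as sides of the N-gon or as diagonals in D) and none of
   whose own diagonals is drawn. *)
Definition region N (D : {set 'I_N * 'I_N}) (S : {set 'I_N}) : bool :=
  [&& 3 <= #|S|,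
      [forall e, is_side S e ==> is_side [set: 'I_N] e || (e \in D)]
    & [forall e, is_diagonal S e ==> (e \notin D)]].

(* No region of an (n+2)-gon has more than n+2 vertices, so j <= n suffices. *)
Definition has_type n (la : seq nat) (D : {set 'I_n.+2 * 'I_n.+2}) : bool :=
  [forall j : 'I_n.+1,
    #|[set S | region D S & #|S| == j.+2]| == count_mem (j : nat) la].

Definition num_dissections (la : seq nat) (n : nat) : nat :=
  #|[set D : {set 'I_n.+2 * 'I_n.+2} | dissection D & has_type la D]|.

Inductive ptree : Type := Node of seq ptree.

(* The downdegrees of all the vertices, in preorder. *)
Fixpoint downdegrees (t : ptree) : seq nat :=
  let: Node ts := t in size ts :: flatten (map downdegrees ts).

Definition num_vertices (t : ptree) : nat := size (downdegrees t).

Fixpoint ptree_encode (t : ptree) : GenTree.tree unit :=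
  let: Node ts := t in GenTree.Node 0 (map ptree_encode ts).

Fixpoint ptree_decode (g : GenTree.tree unit) : ptree :=
  if g is GenTree.Node _ gs then Node (map ptree_decode gs) else Node [::].

Lemma ptree_encodeK : cancel ptree_encode ptree_decode.
Proof.
rewrite /cancel; fix IH 1; case=> ts /=; congr Node.
by elim: ts => //= t ts ->; rewrite IH.
Qed.

HB.instance Definition _ := Countable.copy ptree (can_type ptree_encodeK).

(* All forests with at most b vertices (among others). *)
Fixpoint forests (b : nat) : seq (seq ptree) :=
  if b is b'.+1 then
    [::] :: [seq Node f :: g | f <- forests b', g <- forests b']
  else [:: [::]].

Lemma mem_forests b (f : seq ptree) :
  size (flatten (map downdegrees f)) <= b -> f \in forests b.
Proof.
elim: b f => [|b IHb] [|[f1] g] //=.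
rewrite ltnS size_cat => le_b; rewrite inE /=.
apply: allpairs_f; apply: IHb; apply: leq_trans le_b.
  exact: leq_addr.
exact: leq_addl.
Qed.

Record ptree_of_size (N : nat) : Type := PtreeOfSize {
  ptree_val :> ptree;
  _ : num_vertices ptree_val == N
}.

HB.instance Definition _ N := [isSub for @ptree_val N].
HB.instance Definition _ N := [Equality of ptree_of_size N by <:].
HB.instance Definition _ N := [Choice of ptree_of_size N by <:].
HB.instance Definition _ N := [Countable of ptree_of_size N by <:].

Definition ptree_enum N : seq (ptree_of_size N) :=
  undup (pmap insub [seq Node f | f <- forests N]).

Lemma ptree_enumP N : Finite.axiom (ptree_enum N).
Proof.
apply: Finite.uniq_enumP => [|t]; first exact: undup_uniq.
rewrite mem_undup mem_pmap_sub; case: t => -[f] f_N.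
apply: map_f; apply: mem_forests.
by rewrite -[leqRHS](eqP f_N) leqnSn.
Qed.

HB.instance Definition _ N := isFinite.Build (ptree_of_size N) (@ptree_enumP N).

(* r lists r_0, ..., r_m; a vertex of a tree on m+1 vertices has downdegree at
   most m, so this is the whole downdegree sequence. *)
Definition num_trees (r : seq nat) (m : nat) : nat :=
  #|[set t : ptree_of_size m.+1 |
      mkseq (fun j => count_mem j (downdegrees t)) m.+1 == r]|.

Definition pad_zeros (l : nat) (r : seq nat) : seq nat :=
  r ++ nseq (l - size r) 0.

(* Main.v *)
Require Import Defs.
From mathcomp Require Import all_boot zify.

Set Implicit Arguments.
Unset Strict Implicit.
Unset Printing Implicit Defensive.

(* Place the n+1 leaves of a plane tree on the unit intervals [i, i+1] of
   [0, n+1], and attach to each vertex the interval covered by the leaves below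
   it. Read as segments of the (n+2)-gon, the leaves give the sides (i, i+1),
   the root gives the side (0, n+1), and the other vertices give pairwise
   non-crossing diagonals. When no vertex has downdegree 1 these segments are
   distinct, and every dissection arises from exactly one such tree. The region
   just below the segment of an inner vertex has as sides this segment and those
   of the children, so a vertex of downdegree j+1 corresponds to a (j+2)-gon. *)

(** * Forests, their leaves and downdegrees *)

(** Deleting the root of the first tree splits a forest into two: the children of that root and the
    remaining trees. All inductions below follow this splitting. *)
Lemma forest_ind (P : seq ptree -> Prop) :
    P [::] -> (forall f g, P f -> P g -> P (Node f :: g)) ->
  forall f, P f.
Proof.
move=> P0 Pcons.
suff Ptree t : forall g, P g -> P (t :: g).
  by elim=> // t g; apply: Ptree.
move: t; fix IH 1 => -[f] g Pg; apply: Pcons => //.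
elim: f => // t f; exact: IH.
Qed.

Definition degrees (f : seq ptree) : seq nat := flatten (map downdegrees f).

Definition leaves (f : seq ptree) : nat := count_mem 0 (degrees f).

Definition branching (f : seq ptree) : bool := 1 \notin degrees f.

Definition width (t : ptree) : nat := count_mem 0 (downdegrees t).

Lemma degrees_cons f g :
  degrees (Node f :: g) = size f :: degrees f ++ degrees g.
Proof. by []. Qed.

Lemma degrees1 t : degrees [:: t] = downdegrees t.
Proof. by rewrite /degrees /= cats0. Qed.

Lemma leaves1 t : leaves [:: t] = width t.
Proof. by rewrite /leaves degrees1. Qed.

Lemma leaves_cons t g : leaves (t :: g) = width t + leaves g.
Proof. by rewrite /leaves /degrees /= count_cat. Qed.

Lemma width_Node f : width (Node f) = (f == [::]) + leaves f.
Proof. by case: f. Qed.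

Lemma size_leaves f : size f <= leaves f.
Proof.
elim/forest_ind: f => // f g IHf IHg.
rewrite leaves_cons width_Node /=; case: f IHf => [|t f] /=; lia.
Qed.

Lemma width_gt0 t : 0 < width t.
Proof.
case: t => f; rewrite width_Node; case: f => // t f.
by have /= := size_leaves (t :: f); lia.
Qed.

Lemma leaves_width f : leaves f <= width (Node f).
Proof. by rewrite width_Node leq_addl. Qed.

Lemma degrees_le f d : d \in degrees f -> d <= leaves f.
Proof.
elim/forest_ind: f => // f g IHf IHg; rewrite degrees_cons leaves_cons.
have := leaves_width f; have := size_leaves f.
by rewrite inE mem_cat => ? ? /or3P [/eqP ->|/IHf|/IHg]; lia.
Qed.

Lemma branching_cons f g :
  branching (Node f :: g) = [&& size f != 1, branching f & branching g].
Proof.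
by rewrite /branching degrees_cons inE mem_cat !negb_or eq_sym.
Qed.

(** * Intervals and regions attached to the vertices of a forest *)

Section Collect.

Variables (T : Type) (F : nat -> seq ptree -> seq T).

(* The leaves below the vertex being visited occupy the unit intervals that
   start at a, from left to right; F sees a and the children of the vertex. *)
Fixpoint collect_tree (a : nat) (t : ptree) : seq T :=
  let: Node f := t in
  F a f ++ (fix go b g :=
    if g is u :: g' then collect_tree b u ++ go (b + width u) g' else [::]) a f.

Fixpoint collect (a : nat) (f : seq ptree) : seq T :=
  if f is t :: g then collect_tree a t ++ collect (a + width t) g else [::].

Lemma collect_cons a f g :
  collect a (Node f :: g) =
  F a f ++ collect a f ++ collect (a + width (Node f)) g.
Proof. by rewrite catA. Qed.

End Collect.

Definition chords : nat -> seq ptree -> seq (nat * nat) :=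
  collect (fun a f => [:: (a, a + width (Node f))]).

(** The points where consecutive trees of [f] meet, with both outer ends: the corners of the region
    below a vertex whose children are [f]. *)
Fixpoint cuts (a : nat) (f : seq ptree) : seq nat :=
  a :: if f is t :: g then cuts (a + width t) g else [::].

(** Leaves contribute nothing, since their segments have no region below them. *)
Definition polygons : nat -> seq ptree -> seq (seq nat) :=
  collect (fun a f => if f is [::] then [::] else [:: cuts a f]).

Arguments chords : simpl never.
Arguments polygons : simpl never.

(** * Chords of a forest: bounds, non-crossing, reconstruction *)

Lemma mem_chords_cons a f g e :
  (e \in chords a (Node f :: g)) =
  [|| e == (a, a + width (Node f)), e \in chords a f
    | e \in chords (a + width (Node f)) g].
Proof. by rewrite /chords collect_cons /= inE mem_cat. Qed.

Lemma chords_bounds a f x y :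
  (x, y) \in chords a f -> [&& a <= x, x < y & y <= a + leaves f].
Proof.
elim/forest_ind: f a => // f g IHf IHg a.
rewrite mem_chords_cons leaves_cons; have := leaves_width f.
have := width_gt0 (Node f).
by move=> ? ? /or3P [/eqP [-> ->]|/IHf|/IHg]; lia.
Qed.

(** Every tree has positive width, so a chord spanning the whole forest leaves no room for a second
    tree. This is how only children, and later the root, are detected. *)
Lemma chords_whole a f : (a, a + leaves f) \in chords a f -> size f = 1.
Proof.
elim/forest_ind: f a => // f g _ _ a.
rewrite mem_chords_cons leaves_cons; have := leaves_width f.
have := width_gt0 (Node f); have := size_leaves g.
move=> ? ? ? /or3P [/eqP [? ]|/chords_bounds|/chords_bounds]; rewrite /=; lia.
Qed.

Lemma chords_proper a f :
  size f != 1 -> (a, a + width (Node f)) \notin chords a f.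
Proof.
apply: contraNN; rewrite width_Node.
by case: f => // t f /chords_whole ->.
Qed.

Lemma chords_noncrossing a f x y x' y' :
    (x, y) \in chords a f -> (x', y') \in chords a f ->
  ~~ [&& x < x', x' < y & y < y'].
Proof.
elim/forest_ind: f a => // f g IHf IHg a; rewrite !mem_chords_cons.
have := leaves_width f; have := width_gt0 (Node f) => w_gt0 w_ge.
case/or3P => [/eqP [-> ->]|xy|xy];
    case/or3P => [/eqP [-> ->]|xy'|xy'].
- by lia.
- by have := chords_bounds xy'; lia.
- by have := chords_bounds xy'; lia.
- by have := chords_bounds xy; lia.
- exact: IHf xy xy'.
- by have := chords_bounds xy; have := chords_bounds xy'; lia.
- by have := chords_bounds xy; lia.
- by have := chords_bounds xy; have := chords_bounds xy'; lia.
- exact: IHg xy xy'.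
Qed.

Lemma chords_unit a f i : a <= i < a + leaves f -> (i, i.+1) \in chords a f.
Proof.
elim/forest_ind: f a => [a|f g IHf IHg a]; first by rewrite /leaves /=; lia.
rewrite leaves_cons mem_chords_cons => i_bnd.
have [i_lt|i_ge] := ltnP i (a + width (Node f)); last first.
  by rewrite IHg ?orbT //; lia.
move: i_bnd i_lt IHf; rewrite width_Node; case: f => [|t f] i_bnd i_lt IHf.
  have -> : i = a by move: i_lt; rewrite /leaves /=; lia.
  by rewrite /leaves addn1 eqxx.
by rewrite IHf ?orbT //; move: i_lt => /=; lia.
Qed.

Lemma uniq_chords a f : branching f -> uniq (chords a f).
Proof.
elim/forest_ind: f a => // f g IHf IHg a.
rewrite branching_cons => /and3P [f1 bf bg].
rewrite /chords collect_cons /= cat_uniq -!/(chords _ _) IHf // IHg // andbT.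
rewrite mem_cat negb_or chords_proper //=; apply/andP; split.
  by apply/negP => /chords_bounds; have := width_gt0 (Node f); lia.
apply/hasPn => -[x y] /chords_bounds xy; apply/negP => /chords_bounds.
by have := leaves_width f; lia.
Qed.

(* The first tree of a forest is read off from the longest chord that starts at
   the left end of the forest. *)
Lemma chords_inj a f g :
  branching f -> branching g -> chords a f =i chords a g -> f = g.
Proof.
elim/forest_ind: f a g => [|f1 f2 IH1 IH2] a [|[g1] g2] //.
- by move=> _ _ /(_ (a, a + width (Node g1))); rewrite mem_chords_cons eqxx.
- by move=> _ _ /(_ (a, a + width (Node f1))); rewrite mem_chords_cons eqxx.
rewrite !branching_cons => /and3P [f1s bf1 bf2] /and3P [g1s bg1 bg2] eq_fg.
have wf := width_gt0 (Node f1); have wg := width_gt0 (Node g1).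
have lf := leaves_width f1; have lg := leaves_width g1.
have eq_w : width (Node f1) = width (Node g1).
  have := eq_fg (a, a + width (Node f1)); have := eq_fg (a, a + width (Node g1)).
  rewrite !mem_chords_cons !eqxx /= => /or3P gP /esym/or3P fP.
  case: gP => [/eqP []|/chords_bounds|/chords_bounds];
  case: fP => [/eqP []|/chords_bounds|/chords_bounds]; lia.
have fN := chords_proper a f1s; have gN := chords_proper a g1s.
have -> : f1 = g1.
  apply: (IH1 a) => // -[x y]; have := eq_fg (x, y).
  rewrite !mem_chords_cons -eq_w.
  have [-> _|/= ne] := eqVneq (x, y) (a, a + width (Node f1)).
    by rewrite (negbTE fN) eq_w (negbTE gN).
  case: (boolP (y <= a + width (Node f1))) => y_le.
    have out h : ((x, y) \in chords (a + width (Node f1)) h) = false.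
      by apply/negP => /chords_bounds; lia.
    by rewrite !out !orbF.
  by move=> _; apply/idP/idP => /chords_bounds; lia.
have -> // : f2 = g2.
apply: (IH2 (a + width (Node f1))) => // -[x y]; have := eq_fg (x, y).
rewrite !mem_chords_cons -eq_w.
case: (boolP (a + width (Node f1) <= x)) => x_ge.
  have -> : ((x, y) == (a, a + width (Node f1))) = false.
    by apply/eqP => -[]; lia.
  have -> : ((x, y) \in chords a f1) = false.
    by apply/negP => /chords_bounds; lia.
  have -> // : ((x, y) \in chords a g1) = false.
  by apply/negP => /chords_bounds; lia.
by move=> _; apply/idP/idP => /chords_bounds; lia.
Qed.

(** Greedy reconstruction: the first tree spans [[a, c]] for the largest [c] with [E a c]. The
    segments strictly inside [[a, c]] give its children, those in [[c, b]] the remaining trees. *)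
Lemma chords_surj (E : rel nat) a b :
    a <= b ->
    (forall i, a <= i < b -> E i i.+1) ->
    (forall x y x' y', E x y -> E x' y' -> a <= x -> y' <= b ->
       ~~ [&& x < x', x' < y & y < y']) ->
  exists f, [/\ branching f, leaves f = b - a &
    forall x y, ((x, y) \in chords a f) = [&& a <= x, x < y, y <= b & E x y]].
Proof.
(* If [c = b], the call for the children keeps the interval but removes [(a, b)] from the relation,
   so the summand [E a b] drops from 1 to 0. Otherwise the interval shrinks, and the factor 2
   outweighs any growth of that summand. *)
have [k] := ubnP ((b - a).*2 + E a b).
elim: k E a b => // k IH E a b lt_k le_ab Eunit Encr.
case: (ltngtP a b) le_ab => // [lt_ab _|eq_ab _]; last first.
  exists [::]; split; rewrite // ?eq_ab ?subnn // => x y.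
  by apply/esym; rewrite in_nil; lia.
have exy : exists y, [&& a < y, y <= b & E a y].
  by exists a.+1; rewrite Eunit ?leqnn //; lia.
have bnd y : [&& a < y, y <= b & E a y] -> y <= b by case/and3P.
case: (ex_maxnP exy bnd) => {exy bnd} c /and3P [lt_ac le_cb Eac] c_max.
have [g [bg lg chg]] : exists g, [/\ branching g, leaves g = b - c &
    forall x y, ((x, y) \in chords c g) = [&& c <= x, x < y, y <= b & E x y]].
  apply: IH => //; first by case: (E c b) (E a b) lt_k => [] []; lia.
    by move=> i ?; apply: Eunit; lia.
  by move=> x y x' y' Exy Exy' ? ?; apply: Encr => //; lia.
have [f [bf wf f1 chf]] : exists f, [/\ branching f, width (Node f) = c - a,
    size f != 1 & forall x y, ((x, y) \in chords a f) =
      [&& a <= x, x < y, y <= c, E x y & (x, y) != (a, c)]].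
  (* A unit interval is a leaf; it is treated apart because removing [(a, c)] would then destroy a
     unit segment. *)
  have [c_a|c_a] := eqVneq c a.+1.
    exists [::]; split; rewrite ?c_a ?subSnn // => x y.
    apply/esym/negP => /and5P [? ? ? ? /eqP []].
    by congr (_, _); lia.
  pose E' : rel nat := fun x y => E x y && ((x, y) != (a, c)).
  have [f [bf lf chf]] : exists f, [/\ branching f, leaves f = c - a &
      forall x y, ((x, y) \in chords a f) =
        [&& a <= x, x < y, y <= c & E' x y]].
    apply: IH; first 1 last.
    - by lia.
    - move=> i ?; rewrite /E' Eunit; last by lia.
      by apply/eqP => -[]; lia.
    - move=> x y x' y' /andP [Exy _] /andP [Exy' _] ? ?.
      by apply: Encr => //; lia.
    rewrite /E' eqxx andbF.
    move: lt_k; have [<-|] := eqVneq c b; first by rewrite Eac; lia.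
    by case: (E a b); lia.
  have f_neq : f != [::] by case: f lf {bf chf} => //; rewrite /leaves /=; lia.
  exists f; split => //; first by rewrite width_Node (negbTE f_neq) lf.
  (* A single child would have [(a, c)] as its chord, which [E'] excludes. *)
  apply/eqP => f1; case: f f1 {f_neq} bf lf chf => [|[h] [|]] // _ _ lf.
  move=> /(_ a c); rewrite mem_chords_cons -leaves1 lf subnKC; last by lia.
  by rewrite /E' !eqxx /= !andbF.
exists (Node f :: g); split.
- by rewrite branching_cons f1 bf.
- by rewrite leaves_cons wf lg; lia.
move=> x y; rewrite mem_chords_cons wf subnKC; last by lia.
rewrite chf chg; have [[-> ->]|ne] := eqVneq (x, y) (a, c).
  by rewrite Eac; lia.
rewrite /= andbT; case Exy : (E x y); last by rewrite !andbF.
(* No segment straddles [c]: one starting at [a] would contradict the maximality of [c], one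
   starting later would cross [(a, c)]. *)
rewrite !andbT; have [x_a|x_a] := eqVneq x a.
  have ? : y <= b -> a < y -> y <= c.
    by move=> y_le y_gt; apply: c_max; rewrite y_gt y_le -x_a.
  by lia.
by case: (leqP y b) => [le_yb|]; [have := Encr _ _ _ _ Eac Exy|]; lia.
Qed.

(** * Polygons as sorted vertex lists *)

(** For [x < y] in a sorted list [s], this says that [x] and [y] are consecutive in [s]. *)
Definition gap (s : seq nat) (x y : nat) : bool :=
  all (fun z => (z <= x) || (y <= z)) s.

Arguments gap : simpl never.

Definition ends (s : seq nat) : nat * nat := (head 0 s, last 0 s).

(* For s sorted, E contains the sides of the polygon with vertex list s (the
   segments joining consecutive elements, and the one joining the first to the
   last) but none of its diagonals. *)
Definition is_polygon (E : seq (nat * nat)) (s : seq nat) : Prop :=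
  {in s &, forall x y, x < y ->
     (gap s x y || ((x, y) == ends s)) = ((x, y) \in E)}.

Lemma head_le_last s z :
  sorted ltn s -> z \in s -> head 0 s <= z <= last 0 s.
Proof.
elim: s z => [|x [|y s] IH] z //=; first by rewrite inE => _ /eqP ->; lia.
move=> /andP [lt_xy ys]; rewrite inE => /orP [/eqP ->|zs].
  by have := IH y ys (mem_head _ _) => /=; lia.
by have := IH z ys zs => /=; lia.
Qed.

Lemma sorted_gap s : sorted ltn s -> sorted (gap s) s.
Proof.
(* The gaps refer to the whole list while the induction consumes it; the prefix [r] keeps the part
   already passed. *)
suff gen r : sorted ltn (r ++ s) -> sorted (gap (r ++ s)) s by apply: (gen [::]).
elim: s r => // x [|y s] // IH r srt.
have := IH (rcons r x); rewrite cat_rcons => /(_ srt) /= ->.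
rewrite andbT; apply/allP => z; rewrite mem_cat => /orP [zr|].
  move: srt; rewrite sorted_pairwise; last exact: ltn_trans.
  rewrite pairwise_cat => /and3P [/allrelP rs _ _].
  by have := rs z x zr (mem_head _ _) => /=; lia.
have srt_s := subseq_sorted ltn_trans (suffix_subseq r _) srt.
move=> zs; have /= := head_le_last srt_s zs.
move: zs; rewrite inE => /orP [/eqP ->|zs]; first by rewrite leqnn.
by have /= := head_le_last (path_sorted srt_s) zs; lia.
Qed.

(** A discrete intermediate value argument: the first step that rises above [c] has to start at [c],
    as no step jumps over it. *)
Lemma path_through (e : rel nat) c x s :
    path e x s -> x <= c -> c <= last x s ->
    {in x :: s &, forall y z, e y z -> ~~ [&& y < c & c < z]} ->
  c \in x :: s.
Proof.
elim: s x => [|y s IH] x /=; first by rewrite inE; lia.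
case/andP => exy ys le_xc le_cl jump; rewrite inE.
have [le_yc|lt_cy] := leqP y c.
  rewrite IH ?orbT // => u v us vs; apply: jump; by rewrite inE ?us ?vs orbT.
by have := jump x y (mem_head _ _); rewrite !inE eqxx orbT => /(_ isT exy); lia.
Qed.

Lemma cuts_cons a f : cuts a f = a :: behead (cuts a f).
Proof. by case: f. Qed.

Lemma head_cuts a f : head 0 (cuts a f) = a.
Proof. by case: f. Qed.

Lemma size_cuts a f : size (cuts a f) = (size f).+1.
Proof. by elim: f a => //= t f IH a; rewrite IH. Qed.

Lemma last_cuts x a f : last x (cuts a f) = a + leaves f.
Proof.
elim: f a x => [|t f IH] a x; first by rewrite /leaves /= addn0.
by rewrite [cuts _ _]/= [last _ _]/= IH leaves_cons addnA.
Qed.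

Lemma sorted_cuts a f : sorted ltn (cuts a f).
Proof.
elim: f a => // t f IH a; have := IH (a + width t).
rewrite /= (cuts_cons (a + width t)) /= => ->.
by have := width_gt0 t; lia.
Qed.

Lemma gap_cons x s u v : x <= u -> gap (x :: s) u v = gap s u v.
Proof. by rewrite /gap /= => ->. Qed.

(* Both directions peel off the first tree: the cut point between this tree and
   the rest cannot be jumped over, and it is joined to a by a chord. *)
Lemma cutsP a f s :
    sorted ltn s -> head 0 s = a -> last 0 s = a + leaves f -> 0 < size s ->
  s = cuts a f <->
  {in s &, forall x y, x < y -> gap s x y = ((x, y) \in chords a f)}.
Proof.
elim/forest_ind: f a s => [|f g _ IH] a [|h s] // srt /= h_a; subst h.
  rewrite /leaves /= addn0; case: s srt => [|x s] srt /= las _.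
    by split=> // _ x y; rewrite !inE => /eqP -> /eqP ->; rewrite ltnn.
  have := head_le_last srt (mem_last _ _); have /= /andP [lt_ax _] := srt.
  have := head_le_last srt (mem_nth 0 (isT : 1 < size (a :: x :: s))).
  by rewrite /= las; lia.
rewrite leaves_cons addnA => las _.
set c := a + width (Node f) in las *; have lt_ac : a < c.
  by have := width_gt0 (Node f); rewrite /c; lia.
have lf := leaves_width f.
have chE x y : x < y -> c < y -> x < c ->
    ((x, y) \in chords a (Node f :: g)) = false.
  move=> ? ? ?; rewrite mem_chords_cons -/c; apply/negP.
  by case/or3P => [/eqP []|/chords_bounds|/chords_bounds];
    rewrite /c in lt_ac *; lia.
have chE2 x y : c <= x ->
    ((x, y) \in chords a (Node f :: g)) = ((x, y) \in chords c g).
  move=> le_cx; rewrite mem_chords_cons -/c.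
  have -> : ((x, y) == (a, c)) = false by apply/eqP => -[]; lia.
  have -> // : (x, y) \in chords a f = false.
  by apply/negP => /chords_bounds; rewrite /c in le_cx; lia.
have ch_ac : (a, c) \in chords a (Node f :: g) by rewrite mem_chords_cons eqxx.
(* Once the second entry is [c], the only consecutive pair outside the tail is [(a, c)], and the
   chords starting at [c] or later are those of [g]. *)
suff main : (forall y s', s = y :: s' -> y = c ->
    ({in a :: s &, forall x z, x < z ->
       gap (a :: s) x z = ((x, z) \in chords a (Node f :: g))} <->
     {in s &, forall x z, x < z -> gap s x z = ((x, z) \in chords c g)})).
  split.
    case=> s_eq; have s_eq' : s = c :: behead (cuts c g).
      by rewrite s_eq -cuts_cons.
    apply/(main _ _ s_eq' erefl)/(IH c) => //.
    - exact: path_sorted srt.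
    - by rewrite s_eq head_cuts.
    - by rewrite s_eq last_cuts.
    - by rewrite s_eq'.
  move=> ch; have c_in : c \in a :: s.
    have /= pth := sorted_gap srt.
    apply: (path_through pth); [exact: ltnW | by rewrite las leq_addr|].
    move=> x y xs ys gp; apply/negP => /andP [? ?].
    have lt_xy : x < y by lia.
    by move: gp; rewrite ch // chE.
  case: s srt las main ch c_in => [|y s] srt las main ch c_in.
    by move: c_in; rewrite inE; lia.
  have /= /andP [lt_ay _] := srt.
  (* The chord [(a, c)] makes [a] and [c] consecutive, so no entry precedes [c] other than [a]. *)
  have y_c : y = c.
    have := ch a c (mem_head _ _) c_in lt_ac; rewrite ch_ac => /allP gac.
    have := gac y; rewrite !inE eqxx orbT => /(_ isT) gy.
    have := head_le_last (path_sorted srt) (z := c).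
    by move: c_in; rewrite inE => /orP [/eqP|->]; [lia|move=> /(_ isT) /=; lia].
  congr (_ :: _); apply/(IH c) => //; first exact: path_sorted srt.
  by apply/main => //.
move=> y s' s_eq y_c; subst y s.
have in_c z : z \in c :: s' -> c <= z.
  by move=> /(head_le_last (path_sorted srt)) /=; lia.
split=> ch x z xs zs lt_xz.
  have ax : a <= x by have := in_c _ xs; lia.
  have inS u : u \in c :: s' -> u \in [:: a, c & s'].
    by move=> us; rewrite in_cons us orbT.
  rewrite -(gap_cons _ _ ax) -chE2 ?in_c //.
  by apply: ch lt_xz; apply: inS.
move: xs zs; rewrite !(in_cons a) => /orP [/eqP x_a|xs] /orP [/eqP z_a|zs].
- by lia.
- have := in_c _ zs; rewrite leq_eqVlt => /orP [/eqP <-|lt_cz].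
    rewrite x_a ch_ac; apply/allP => u; rewrite in_cons => /orP [/eqP ->|/in_c ->].
      by rewrite leqnn.
    by rewrite orbT.
  rewrite chE //; last by lia.
  by apply/negP => /allP /(_ c); rewrite !inE eqxx orbT => /(_ isT); lia.
- by have := in_c _ xs; lia.
- have ax : a <= x by have := in_c _ xs; lia.
  by rewrite chE2 ?in_c // (gap_cons _ _ ax); apply: ch.
Qed.

(** * The regions cut out by the chords of a forest *)

Lemma polygons_cons a f g :
  polygons a (Node f :: g) =
  (if f is [::] then [::] else [:: cuts a f])
    ++ polygons a f ++ polygons (a + width (Node f)) g.
Proof. exact: collect_cons. Qed.

Lemma ends_cuts a f : ends (cuts a f) = (a, a + leaves f).
Proof. by rewrite /ends head_cuts last_cuts. Qed.

(** The segment joining the ends of a region is the chord of the inner vertex above it. Distinct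
    chords therefore give distinct regions. *)
Lemma subseq_ends_polygons a f :
  subseq (map ends (polygons a f)) (chords a f).
Proof.
elim/forest_ind: f a => // f g IHf IHg a.
rewrite polygons_cons /chords collect_cons !map_cat; apply: cat_subseq.
  case: f {IHf} => // t f.
  rewrite -[map _ _]/[:: ends (cuts a (t :: f))] ends_cuts width_Node.
  exact: subseq_refl.
exact: cat_subseq.
Qed.

Lemma uniq_polygons a f : branching f -> uniq (polygons a f).
Proof.
move=> /(uniq_chords a)/(subseq_uniq (subseq_ends_polygons a f)).
exact: map_uniq.
Qed.

Lemma polygons_ends a f s : s \in polygons a f -> ends s \in chords a f.
Proof. by move=> s_in; apply/(mem_subseq (subseq_ends_polygons a f))/map_f. Qed.

Lemma polygons_sorted a f s : s \in polygons a f -> sorted ltn s.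
Proof.
elim/forest_ind: f a => // f g IHf IHg a; rewrite polygons_cons !mem_cat.
case/or3P => [|/IHf|/IHg] //; case: f {IHf} => // t f.
rewrite inE => /eqP ->; exact: sorted_cuts.
Qed.

Lemma count_polygons a f j :
  count (fun s => size s == j.+2) (polygons a f) = count_mem j.+1 (degrees f).
Proof.
elim/forest_ind: f a => // f g IHf IHg a.
rewrite polygons_cons degrees_cons /= !count_cat IHf IHg; congr (_ + _).
by case: f {IHf} => // t f; rewrite /= size_cuts addn0.
Qed.

Lemma is_polygon_ends E s :
  sorted ltn s -> 1 < size s -> is_polygon E s -> ends s \in E.
Proof.
case: s => [|x [|y s]] // srt _ pol.
have /= lt_xl : x < last 0 [:: x, y & s].
  have /= /andP [lt_xy _] := srt.
  by have := head_le_last (path_sorted srt) (mem_head y s) => /=; lia.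
have := pol _ _ (mem_head _ _) (mem_last x (y :: s)) lt_xl.
by rewrite eqxx orbT.
Qed.

(** The ends of [s] form a chord. If it is the chord [(a, c)] of the first root, [cutsP] identifies
    [s]. Otherwise it lies in [f] or in [g]; all vertices of [s] lie between its ends, so only the
    chords of that subforest matter and induction applies. *)
Lemma polygonsP a f s :
    branching f -> sorted ltn s -> 2 < size s ->
  s \in polygons a f <-> is_polygon (chords a f) s.
Proof.
elim/forest_ind: f a => [|f g IHf IHg] a bfg srt s3.
  by split=> // pol; have := is_polygon_ends srt (ltnW s3) pol.
move: bfg; rewrite branching_cons => /and3P [f1 bf bg].
have {}IHf := IHf a bf srt s3; have {}IHg := IHg (a + width (Node f)) bg srt s3.
set c := a + width (Node f) in IHg *.
have lf := leaves_width f; have w0 := width_gt0 (Node f).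
have ac_f : (a, c) \notin chords a f := chords_proper a f1.
have in_ends x : x \in s -> (ends s).1 <= x <= (ends s).2 by exact: head_le_last.
have s_ge2 : 1 < size s by exact: ltnW.
rewrite polygons_cons !mem_cat -/c.
have transfer E : {in s &, forall x y, x < y ->
    ((x, y) \in chords a (Node f :: g)) = ((x, y) \in E)} ->
    is_polygon E s <-> is_polygon (chords a (Node f :: g)) s.
  by move=> eqE; split=> pol x y xs ys lt_xy; rewrite pol ?eqE.
have top : (s \in (if f is [::] then [::] else [:: cuts a f])) ->
    ends s = (a, c) /\ s = cuts a f.
  rewrite /c width_Node; case: (f) => // t f'; rewrite inE => /eqP ->.
  by rewrite ends_cuts.
have [e_top|e_ntop] := eqVneq (ends s) (a, c).
  have -> : (s \in polygons a f) = false.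
    by apply/negP => /polygons_ends; rewrite e_top (negbTE ac_f).
  have -> : (s \in polygons c g) = false.
    by apply/negP => /polygons_ends; rewrite e_top => /chords_bounds;
      rewrite /c; lia.
  rewrite !orbF.
  (* The interval of a leaf has length 1 and cannot hold three vertices. *)
  have f_neq : f != [::].
    apply/eqP => f0; move: s3 in_ends srt; rewrite e_top /c f0 /=.
    have -> : width (Node [::]) = 1 by [].
    case: s {e_top IHf IHg transfer top s_ge2} => [|x [|y [|z s]]] //= _ bnd.
    have := bnd x; have := bnd y; have := bnd z; rewrite !inE !eqxx !orbT.
    by move=> /(_ isT) + /(_ isT) + /(_ isT); lia.
  have c_eq : c = a + leaves f by rewrite /c width_Node (negbTE f_neq).
  have -> : (s \in (if f is [::] then [::] else [:: cuts a f])) = (s == cuts a f).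
    by case: (f) f_neq => // t f'; rewrite inE.
  have [e1 e2] : head 0 s = a /\ last 0 s = c by case: e_top.
  (* A third vertex separates the ends, so [(a, c)] is not a consecutive pair, in accordance with
     its absence from [chords a f]. *)
  have ngap : gap s a c = false.
    apply/negP; case: s s3 srt e1 e2 {IHf IHg transfer top s_ge2 in_ends e_top}
      => [|x [|y [|z s]]] //= _ /and3P [lt_xy lt_yz pz] <- e2.
    have := head_le_last (s := z :: s) pz (mem_head _ _).
    rewrite /= e2 => zc /allP /(_ y); rewrite !inE eqxx orbT => /(_ isT).
    by lia.
  have cP := @cutsP a f s srt e1; rewrite -c_eq in cP.
  have {}cP := cP e2 (ltnW s_ge2).
  split=> [/eqP /cP|] pol.
    move=> x y xs ys lt_xy; rewrite pol // e_top mem_chords_cons -/c orbC.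
    congr (_ || _); have -> : ((x, y) \in chords c g) = false; last by rewrite orbF.
    by apply/negP => /chords_bounds; have := in_ends _ ys; rewrite e_top /=; lia.
  apply/eqP/cP => x y xs ys lt_xy; have := pol x y xs ys lt_xy.
  rewrite e_top mem_chords_cons -/c.
  have [[-> ->] _|_ /=] := eqVneq (x, y) (a, c); first by rewrite ngap (negbTE ac_f).
  rewrite orbF => ->; have -> : ((x, y) \in chords c g) = false; last by rewrite orbF.
  by apply/negP => /chords_bounds; have := in_ends _ ys; rewrite e_top /=; lia.
have -> : (s \in (if f is [::] then [::] else [:: cuts a f])) = false.
  by apply/negP => /top [e_top]; rewrite e_top eqxx in e_ntop.
rewrite /=.
have left : ends s \in chords a f -> (is_polygon (chords a f) s <->
    is_polygon (chords a (Node f :: g)) s).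
  move=> /[dup] e_in; rewrite [ends s]surjective_pairing => /chords_bounds bnd.
  apply: transfer => x y xs ys lt_xy; rewrite mem_chords_cons -/c.
  have bx := in_ends _ xs; have b_y := in_ends _ ys.
  have -> : ((x, y) == (a, c)) = false.
    apply/eqP => -[xa yc]; move: e_ntop; rewrite [ends s]surjective_pairing.
    by move=> /eqP []; congr (_, _); rewrite /c in yc *; lia.
  have -> : ((x, y) \in chords c g) = false; last by rewrite orbF.
  by apply/negP => /chords_bounds; rewrite /c; lia.
have right : ends s \in chords c g -> (is_polygon (chords c g) s <->
    is_polygon (chords a (Node f :: g)) s).
  move=> /[dup] e_in; rewrite [ends s]surjective_pairing => /chords_bounds bnd.
  apply: transfer => x y xs ys lt_xy; rewrite mem_chords_cons -/c.
  have bx := in_ends _ xs; have b_y := in_ends _ ys.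
  have -> : ((x, y) == (a, c)) = false by apply/eqP => -[]; rewrite /c in bnd *; lia.
  have -> // : ((x, y) \in chords a f) = false.
  by apply/negP => /chords_bounds; rewrite /c in bnd; lia.
split=> [/orP [s_in|s_in]|pol].
- by apply/left/IHf => //; apply: polygons_ends.
- by apply/right/IHg => //; apply: polygons_ends.
have := is_polygon_ends srt s_ge2 pol; rewrite mem_chords_cons -/c.
rewrite (negbTE e_ntop) /= => /orP [e_in|e_in].
  by apply/orP; left; apply/IHf/(left e_in).
by apply/orP; right; apply/IHg/(right e_in).
Qed.

Lemma polygons_size a f s :
  branching f -> s \in polygons a f -> 2 < size s.
Proof.
elim/forest_ind: f a => // f g IHf IHg a.
rewrite branching_cons polygons_cons !mem_cat => /and3P [f1 bf bg].
case/or3P => [|/IHf|/IHg]; try by apply.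
case: f f1 {IHf bf} => // t f f1; rewrite inE => /eqP ->.
by rewrite size_cuts; move: f1; rewrite /=; lia.
Qed.

(** * Vertex sets as increasing lists, and their sides *)

Section Vertices.

Variable N : nat.
Implicit Type S : {set 'I_N}.

Definition vertices S : seq nat := map val (enum S).

Lemma sorted_vertices S : sorted ltn (vertices S).
Proof.
rewrite /vertices sorted_map /enum_mem; apply: sorted_filter => [? ? ?|].
  exact: ltn_trans.
by rewrite -enumT -(sorted_map (f := val)) val_enum_ord iota_ltn_sorted.
Qed.

Lemma mem_vertices S (i : 'I_N) : (val i \in vertices S) = (i \in S).
Proof. by rewrite mem_map ?mem_enum //; apply: val_inj. Qed.

Lemma size_vertices S : size (vertices S) = #|S|.
Proof. by rewrite size_map -cardE. Qed.

Lemma vertices_inj : injective vertices.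
Proof. by move=> S S' eqS; apply/setP => i; rewrite -!mem_vertices eqS. Qed.

Lemma vertices_onto s :
  sorted ltn s -> {in s, forall x, x < N} -> exists S, vertices S = s.
Proof.
move=> srt s_lt; exists [set i | val i \in s].
apply: (irr_sorted_eq ltn_trans ltnn) => //; first exact: sorted_vertices.
move=> x; apply/mapP/idP => [[i]|xs]; first by rewrite mem_enum inE => ? ->.
by exists (Ordinal (s_lt x xs)); rewrite // mem_enum inE.
Qed.

(** The two alternatives in [is_side] become those of [is_polygon]: if all vertices of [S] lie
    between the endpoints of [e], these are its first and last vertex. *)
Lemma is_sideE S (e : 'I_N * 'I_N) :
    is_segment e -> e.1 \in S -> e.2 \in S ->
  is_side S e = gap (vertices S) e.1 e.2
                || ((val e.1, val e.2) == ends (vertices S)).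
Proof.
move=> seg e1S e2S; rewrite /is_side seg e1S e2S /=; congr (_ || _).
  rewrite /gap all_map; apply/forall_inP/allP => /= gp i iS; apply: gp;
    by rewrite ?mem_enum // -mem_enum.
have srt := sorted_vertices S.
have e1s : val e.1 \in vertices S by rewrite mem_vertices.
have e2s : val e.2 \in vertices S by rewrite mem_vertices.
apply/forall_inP/eqP => [btw|[e1h e2l] i iS].
  have {}btw x : x \in vertices S -> e.1 <= x <= e.2.
    by case/mapP => i; rewrite mem_enum => /btw ? ->.
  have := head_le_last srt e1s; have := head_le_last srt e2s.
  rewrite /ends; case: (vertices S) e1s btw => // x s _ btw.
  have := btw _ (mem_head _ _); have := btw _ (mem_last _ _) => /=.
  by move=> ? ? ? ?; congr (_, _); lia.
by rewrite e1h e2l; apply: head_le_last; rewrite ?mem_vertices.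
Qed.

End Vertices.

Lemma is_sideT n (e : 'I_n.+2 * 'I_n.+2) :
  is_side [set: 'I_n.+2] e =
  (e.2 == e.1.+1 :> nat) || (e.1 == 0 :> nat) && (e.2 == n.+1 :> nat).
Proof.
case: e => i j; rewrite /is_side /is_segment !in_setT /=.
have i_lt := ltn_ord i; have j_lt := ltn_ord j.
apply/andP/orP => [[lt_ij /orP [/forall_inP out|/forall_inP btw]]|].
- left; have lt_i1 : i.+1 < n.+2 by lia.
  by have /= := out (Ordinal lt_i1) (in_setT _); lia.
- right; have /= := btw ord0 (in_setT _); have /= := btw ord_max (in_setT _); lia.
case=> [/eqP ji|/andP [/eqP i0 /eqP jn]].
  split; first by lia.
  by apply/orP; left; apply/forall_inP => s _; lia.
split; first by lia.
by apply/orP; right; apply/forall_inP => s _; have := ltn_ord s; lia.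
Qed.

(** * From trees to dissections and back *)

Section TreeDissection.

Variable n : nat.

Definition tree_dissection (t : ptree) : {set 'I_n.+2 * 'I_n.+2} :=
  [set e | is_diagonal [set: 'I_n.+2] e
         & (val e.1, val e.2) \in chords 0 [:: t]].

(** The diagonal filter in [tree_dissection] loses only sides of the (n+2)-gon, and every such side
    is a chord: of a leaf, or of the root. *)
Lemma drawnE t (e : 'I_n.+2 * 'I_n.+2) : width t = n.+1 ->
  is_side [set: 'I_n.+2] e || (e \in tree_dissection t) =
  ((val e.1, val e.2) \in chords 0 [:: t]).
Proof.
move=> wt; have lt1 : leaves [:: t] = n.+1 by rewrite leaves1.
rewrite inE /is_diagonal !in_setT /=.
case: (boolP (is_side _ e)) => [|_] /=; last first.
  apply/andP/idP => [[]|] // ch; split=> //.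
  by have := chords_bounds ch; rewrite /is_segment; lia.
rewrite is_sideT => /orP [/eqP e12|/andP [/eqP e1 /eqP e2]].
  by rewrite e12; apply/esym/chords_unit; rewrite lt1; have := ltn_ord e.2; lia.
rewrite /= e1 e2; case: t wt {lt1} => f wt.
by rewrite mem_chords_cons wt eqxx.
Qed.

Lemma dissection_tree t : width t = n.+1 -> dissection (tree_dissection t).
Proof.
move=> wt; apply/andP; split; apply/forall_inP => e; rewrite inE => /andP [] //.
move=> _ ech; apply/forall_inP => f; rewrite inE => /andP [_ fch].
have := chords_noncrossing ech fch; have := chords_noncrossing fch ech.
by rewrite /crossing /=; lia.
Qed.

(** Both sides say that a segment between vertices of [S] is drawn exactly when it is a side of [S];
    by [drawnE] and [is_sideE] this is the criterion of [polygonsP]. *)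
Lemma regionE t (S : {set 'I_n.+2}) :
    width t = n.+1 -> branching [:: t] ->
  region (tree_dissection t) S = (vertices S \in polygons 0 [:: t]).
Proof.
move=> wt bt; have srt := sorted_vertices S.
have polP := polygonsP 0 bt srt.
apply/idP/idP => [/and3P [S3 sides diags]|S_in].
  rewrite -size_vertices in S3; apply/(polP S3).
  move=> _ _ /mapP [i + ->] /mapP [j + ->].
  rewrite !mem_enum => iS jS lt_ij; rewrite -(@is_sideE _ S (i, j)) //.
  rewrite -(drawnE (i, j) wt).
  have := forallP sides (i, j); have := forallP diags (i, j).
  rewrite /is_diagonal /= iS jS /is_segment lt_ij /=.
  case: (boolP (is_side S (i, j))) => /= [_ _ -> //|nside ijD _].
  (* A side of the whole polygon with both endpoints in [S] is also a side of [S]. *)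
  rewrite (negbTE ijD) orbF; apply/esym/negbTE; apply: contra nside.
  rewrite /is_side iS jS !in_setT /=.
  move=> /andP [-> /orP [/forall_inP out|/forall_inP btw]].
    by apply/orP; left; apply/forall_inP => s _; exact: out (in_setT s).
  by apply/orP; right; apply/forall_inP => s _; exact: btw (in_setT s).
have S3 := polygons_size bt S_in; have {}polP := (polP S3).1 S_in.
have key e : is_segment e -> e.1 \in S -> e.2 \in S ->
    is_side S e = is_side [set: 'I_n.+2] e || (e \in tree_dissection t).
  move=> seg e1 e2; rewrite drawnE // is_sideE //.
  by apply: polP; rewrite ?mem_vertices.
rewrite /region -size_vertices S3 /=; apply/andP; split; apply/forallP => e;
  apply/implyP.
  by move=> /[dup] sd /and4P [seg e1 e2 _]; rewrite -key.
move=> /and4P [seg e1 e2]; rewrite key //; by rewrite negb_or => /andP [].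
Qed.

Lemma card_regions t j : width t = n.+1 -> branching [:: t] ->
  #|[set S | region (tree_dissection t) S & #|S| == j.+2]| =
  count_mem j.+1 (downdegrees t).
Proof.
move=> wt bt; rewrite -degrees1 -(count_polygons 0) -size_filter cardE.
rewrite -(size_map (@vertices _)); apply: perm_size; apply: uniq_perm.
- by rewrite map_inj_uniq ?enum_uniq //; apply: vertices_inj.
- by rewrite filter_uniq // uniq_polygons.
move=> s; rewrite mem_filter; apply/mapP/andP => [[S]|[/eqP s_j s_in]].
  by rewrite mem_enum inE regionE // -size_vertices => /andP [? ?] ->.
have srt := polygons_sorted s_in.
have s_lt : {in s, forall x, x < n.+2}.
  move=> x /(head_le_last srt); have := polygons_ends s_in.
  by move=> /chords_bounds; rewrite leaves1 wt /=; lia.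
have [S S_s] := vertices_onto srt s_lt.
by exists S; rewrite // mem_enum inE regionE // -size_vertices S_s s_in s_j /=.
Qed.

Lemma tree_dissection_inj t t' :
    width t = n.+1 -> width t' = n.+1 ->
    branching [:: t] -> branching [:: t'] ->
  tree_dissection t = tree_dissection t' -> t = t'.
Proof.
move=> wt wt' bt bt' eqD; suff [] : [:: t] = [:: t'] by [].
apply: (chords_inj (a := 0) bt bt') => -[x y].
have [xy|] := boolP ((x < n.+2) && (y < n.+2)); last first.
  move=> xy; apply/idP/idP => /chords_bounds; rewrite leaves1 ?wt ?wt'; lia.
have /andP [x_lt y_lt] := xy.
have := drawnE (Ordinal x_lt, Ordinal y_lt) wt.
by rewrite eqD (drawnE _ wt') => ->.
Qed.

(** The drawn segments, sides included, satisfy the hypotheses of [chords_surj] on [[0, n+1]]. *)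
Lemma tree_dissection_surj (D : {set 'I_n.+2 * 'I_n.+2}) : dissection D ->
  exists t, [/\ width t = n.+1, branching [:: t] & tree_dissection t = D].
Proof.
case/andP => /forall_inP diag /forall_inP ncr.
pose drawn (e : 'I_n.+2 * 'I_n.+2) := is_side [set: 'I_n.+2] e || (e \in D).
pose E : rel nat := fun x y =>
  [exists e, [&& drawn e, val e.1 == x & val e.2 == y]].
have EP (i j : 'I_n.+2) : E i j = drawn (i, j).
  apply/existsP/idP => [[[i' j']]|dr].
    by case/and3P => dr /= /eqP/val_inj <- /eqP/val_inj <-.
  by exists (i, j); rewrite dr !eqxx.
have Eunit i : 0 <= i < n.+1 -> E i i.+1.
  move=> /andP [_ lt_i]; have lt_i' : i < n.+2 by exact: ltnW.
  have lt_i1 : i.+1 < n.+2 by [].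
  by rewrite (EP (Ordinal lt_i') (Ordinal lt_i1)) /drawn is_sideT /= eqxx.
have Encr x y x' y' : E x y -> E x' y' -> 0 <= x -> y' <= n.+1 ->
    ~~ [&& x < x', x' < y & y < y'].
  case/existsP => -[i j] /and3P [dr /eqP <- /eqP <-].
  case/existsP => -[i' j'] /and3P [dr' /eqP <- /eqP <-] _ _.
  move: dr dr'; rewrite /drawn !is_sideT /=; have := ltn_ord j; have := ltn_ord j'.
  case: (boolP ((i, j) \in D)) => [ijD|_]; last by lia.
  case: (boolP ((i', j') \in D)) => [ijD'|_]; last by lia.
  by have /forall_inP /(_ _ ijD') := ncr _ ijD; rewrite /crossing /=; lia.
have [f [bf lf chf]] := chords_surj (leq0n n.+1) Eunit Encr.
(* The side joining 0 to n+1 is drawn, which forces the forest to be a single tree. *)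
have top : (0, 0 + leaves f) \in chords 0 f.
  rewrite add0n lf subn0 chf /= leqnn.
  by rewrite (EP ord0 ord_max) /drawn is_sideT !eqxx orbT.
have := chords_whole top; case: f bf lf chf {top} => [|t [|]] // bt lt1 cht _.
have wt : width t = n.+1 by rewrite -leaves1 lt1 subn0.
exists t; split=> //; apply/setP => -[i j]; rewrite inE cht EP /drawn /=.
have := ltn_ord j; rewrite ltnS => -> /=.
apply/andP/idP => [[/and4P [_ _ _ /negbTE ->]]|ijD]; first by case/andP.
have dij := diag _ ijD; split=> //.
by have /and4P [+ _ _ _] := dij; rewrite /is_segment /= => ->; rewrite ijD orbT.
Qed.

End TreeDissection.

Theorem theorem1p7 (n : nat) (la : seq nat) (hn : 1 <= n)
    (hla : is_partition n la) :
  let k := size la in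
  let m := n + k in
  let r := pad_zeros m.+1
             [:: n.+1, 0 & [seq count_mem j la | j <- iota 1 n]] in
  num_dissections la n = num_trees r m.
Proof.
move=> k m r; case/and3P: hla => _ la0 /eqP la_n.
have la_le d : d \in la -> d <= n.
  rewrite -la_n; elim: (la) => //= x s IH; rewrite inE.
  by case/orP => [/eqP ->|/IH]; lia.
have la_count0 : count_mem 0 la = 0 by apply/count_memPn.
have la_count d : n < d -> count_mem d la = 0.
  by move=> lt_nd; apply/count_memPn; apply/negP => /la_le; lia.
(* The unpadded list has length n+2, so [k >= 1] is what keeps it within length [m.+1]. *)
have k_gt0 : 0 < k by rewrite /k; case: (la) la_n => //= <- in hn *.
have r_size : size r = m.+1.
  rewrite /r /pad_zeros size_cat size_nseq /= size_map size_iota /m; lia.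
(* Since all parts lie between 1 and n, the 0 at index 1 and the padding are multiplicities in [la]
   too. *)
have rS j : nth 0 r j.+1 = count_mem j la.
  case: j => [|j]; first by rewrite la_count0.
  rewrite /r /pad_zeros nth_cat /= size_map size_iota !ltnS.
  case: ltnP => [lt_jn|le_nj]; last by rewrite nth_nseq if_same la_count.
  by rewrite (nth_map 0) ?size_iota // nth_iota // add1n.
pose A := [set t : ptree_of_size m.+1 |
  mkseq (fun j => count_mem j (downdegrees t)) m.+1 == r].
have AP (t : ptree_of_size m.+1) : t \in A ->
    [/\ width t = n.+1, branching [:: ptree_val t] &
      forall j, j <= n -> count_mem j.+1 (downdegrees t) = count_mem j la].
  rewrite inE => /eqP eq_r.
  have cnt j : j < m.+1 -> count_mem j (downdegrees t) = nth 0 r j.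
    by move=> lt_jm; rewrite -eq_r nth_mkseq.
  split; first by rewrite /width cnt.
    by rewrite /branching degrees1; apply/count_memPn; rewrite cnt // /m; lia.
  by move=> j le_jn; rewrite cnt ?rS // /m; lia.
have -> : num_trees r m = #|A| by [].
have g_inj :
    {in A &, injective (fun t : ptree_of_size m.+1 => tree_dissection n t)}.
  move=> t t' /AP [wt bt _] /AP [wt' bt' _] eqD.
  by apply: val_inj; apply: (tree_dissection_inj wt wt').
rewrite -(card_in_imset g_inj); apply: eq_card => D; rewrite inE.
apply/andP/imsetP => [[dD tyD]|[t /AP [wt bt cnt] ->]]; last first.
  split; first exact: dissection_tree.
  by apply/forallP => j; rewrite card_regions // cnt // -ltnS.
have [t [wt bt tD]] := tree_dissection_surj dD.
have cnt j : j <= n -> count_mem j.+1 (downdegrees t) = count_mem j la.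
  rewrite -ltnS => lt_jn; have /eqP <- := forallP tyD (Ordinal lt_jn).
  by rewrite -tD card_regions.
(* The type controls only [j <= n]; beyond that, a downdegree cannot exceed the number n+1 of
   leaves. *)
have cntS j : count_mem j.+1 (downdegrees t) = count_mem j la.
  have [/cnt //|lt_nj] := leqP j n; rewrite la_count //.
  apply/count_memPn/negP; rewrite -degrees1 => /degrees_le.
  by rewrite leaves1 wt; lia.
(* The counts fix the size of the tree: n+1 leaves and one inner vertex per part, [m.+1] vertices in
   all. *)
have perm_t : perm_eq (downdegrees t) (nseq n.+1 0 ++ map S la).
  apply/allP => -[|j] _ /=; rewrite count_cat count_nseq count_map /=.
    rewrite -/(width t) wt mul1n (eq_count (a2 := pred0)) // count_pred0; lia.
  by rewrite cntS mul0n.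
have size_t : num_vertices t == m.+1.
  by rewrite /num_vertices (perm_size perm_t) size_cat size_nseq size_map.
exists (PtreeOfSize size_t); last by rewrite /= tD.
rewrite inE; apply/eqP; apply: (@eq_from_nth _ 0).
  by rewrite size_mkseq r_size.
move=> [|j]; rewrite size_mkseq => lt_jm; rewrite nth_mkseq //.
by rewrite rS; apply: cntS.
Qed.
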